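(* For every $\varepsilon>0$, there is some $M\in\mathbb{N}$ such that in every $(\frac{1}{4}+\varepsilon)$-dense reduced hypergraph $\mathcal{A}=(I,\mathcal{P}^{ij},\mathcal{A}^{ijk})$, there are indices $i_1,i_2,i_3,i_4\in I$ and vertices $\alpha_{jk}\in\mathcal{P}^{i_j i_k}$ for $jk\in[4]^{(2)}$, as well as vertices $\alpha'_{23}\in\mathcal{P}^{i_2 i_3}$ and $\alpha'_{24}\in\mathcal{P}^{i_2 i_4}$, such that $\alpha_{13}\alpha_{14}\alpha_{34}\in E(\mathcal{A}^{i_1i_3i_4})$, $\alpha_{12}\alpha_{13}\alpha_{23}\in E(\mathcal{A}^{i_1i_2i_3})$, $\alpha_{12}\alpha_{14}\alpha_{24}\in E(\mathcal{A}^{i_1i_2i_4})$, and $\alpha'_{23}\alpha'_{24}\alpha_{34}\in E(\mathcal{A}^{i_2i_3i_4})$.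
   Context: A reduced hypergraph $\mathcal{A}=(I,\mathcal{P}^{ij},\mathcal{A}^{ijk})$ consists of an index set $I$, pairwise disjoint vertex sets $\mathcal{P}^{ij}$ for $ij\in I^{(2)}$, and for each $ijk\in I^{(3)}$ a $3$-partite $3$-graph $\mathcal{A}^{ijk}$ (a constituent) with partition classes $\mathcal{P}^{ij},\mathcal{P}^{ik},\mathcal{P}^{jk}$; its vertex set is $\bigcup_{ij}\mathcal{P}^{ij}$ and edge set $\bigcup_{ijk}E(\mathcal{A}^{ijk})$. For $d\in[0,1]$, $\mathcal{A}$ is called $d$-dense (in the reduced sense) if $e(\mathcal{A}^{ijk})\geq d|\mathcal{P}^{ij}||\mathcal{P}^{ik}||\mathcal{P}^{jk}|$ for all $ijk\in I^{(3)}$.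
   Formalization: The number M is used as a lower bound on the index set, |I| ≥ M (M is otherwise unused and the claim fails for |I| < 4), and all vertex classes P^{ij} are assumed nonempty (with empty classes the density condition holds vacuously and the claim fails). *)

(* Defs.v *)
From HB Require Import structures.
From mathcomp Require Import all_boot all_order all_algebra.
From mathcomp Require Import finmap reals.

Set Implicit Arguments.
Unset Strict Implicit.
Unset Printing Implicit Defensive.

Import Order.TTheory GRing.Theory Num.Theory.
Local Open Scope fset_scope.
Local Open Scope ring_scope.

(* The index set and the ambient set of vertices are arbitrary choice types,
   so the index set may be infinite; each vertex class is finite.  Indices ij
   and ijk are unordered, hence P^{ij} and E(A^{ijk}) are given by functions of
   the finite sets {i,j} and {i,j,k}; values at sets of other sizes are
   irrelevant.  As usual for reduced hypergraphs, vertex classes are nonempty: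
   otherwise the density condition would be satisfied vacuously. *)
Record reduced_hypergraph (I V : choiceType) := ReducedHypergraph {
  rh_class : {fset I} -> {fset V};
  rh_edges : {fset I} -> {fset {fset V}};
  rh_class_neq0 : forall i j : I, i != j -> rh_class [fset i; j] != fset0;
  rh_class_disjoint : forall i j k l : I, i != j -> k != l ->
    [fset i; j] != [fset k; l] ->
    [disjoint rh_class [fset i; j] & rh_class [fset k; l]];
  rh_edges_tripartite : forall i j k : I, uniq [:: i; j; k] ->
    forall e : {fset V}, e \in rh_edges [fset i; j; k] ->
    exists x y z : V,
      [/\ x \in rh_class [fset i; j], y \in rh_class [fset i; k],
          z \in rh_class [fset j; k] & e = [fset x; y; z]]
}.

Definition dense (R : realType) (d : R) (I V : choiceType)
    (A : reduced_hypergraph I V) : Prop :=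
  forall i j k : I, uniq [:: i; j; k] ->
    d * (#|` rh_class A [fset i; j]|)%:R * (#|` rh_class A [fset i; k]|)%:R
      * (#|` rh_class A [fset j; k]|)%:R
    <= (#|` rh_edges A [fset i; j; k]|)%:R.

(* |T| >= m, for a possibly infinite T. *)
Definition card_at_least (T : choiceType) (m : nat) : Prop :=
  exists J : {fset T}, (m <= #|` J|)%N.

(* Main.v *)
Require Import Defs.
From HB Require Import structures.
From mathcomp Require Import all_boot all_order all_algebra.
From mathcomp Require Import finmap reals.
From mathcomp Require Import zify ring lra.
From Stdlib Require Import Classical.

Set Implicit Arguments.
Unset Strict Implicit.
Unset Printing Implicit Defensive.

Import Order.TTheory GRing.Theory Num.Theory.
Local Open Scope fset_scope.
Local Open Scope ring_scope.

(* Let (i, j, k) be increasing indices and let y range over P^{ik}.  Call d_j(y)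
   the proportion of the x in P^{ij} that lie with y in many edges of A^{ijk}.
   Each edge is counted from its apex i and from its apex k, so AM-GM gives
   E_y d_j(y)^2 > 1/4 for one of these two apexes; after Ramsey and possibly
   reversing the order, it is the lowest one for all triples.  By Ramsey again
   there is s such that, for every triple, d_j(y) is almost always at most
   s + o(1), but at least s for a positive proportion of y.

   Fix i first and t last.  Some x in P^{it} has d_j(x) >= s for many j; let
   l < k be among these.  If v in P^{ik} and u in P^{il} are both joined to x,
   then u and v may not be joined (given a suitable z in P^{kt}), so
   d_l(v) <= 1 - s for the proportion s of the v that are joined to x, whence
   E_v d_l(v)^2 <= s (1 - s)^2 + (1 - s) s^2 + o(1) = s (1 - s) + o(1)
   <= 1/4 + o(1), a contradiction.

   "Suitable" means that z, which is not isolated in A^{ikt}, is not isolated in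
   A^{lkt} either.  A last application of Ramsey ensures that the z which are
   isolated towards q given indices l but not towards i are rare.  As v is joined
   to x by many z, fewer than q indices l are then bad for v, and averaging
   gives an l which is good for almost all v. *)

(** * Ramsey's theorem for subsequences, which keep the order of the indices *)

Lemma ramsey (r n1 n2 : nat) :
  exists N, forall (T : eqType) (f : pred (seq T)) (s : seq T), (N <= size s)%N ->
  exists2 t, subseq t s &
    (n1 <= size t)%N /\ (forall u, subseq u t -> size u = r -> f u) \/
    (n2 <= size t)%N /\ (forall u, subseq u t -> size u = r -> ~~ f u).
Proof.
elim: r n1 n2 => [|r IHr] n1 n2.
  exists (maxn n1 n2) => T f s; rewrite geq_max => /andP[s1 s2]; exists s => //.
  case fnil: (f [::]); [left | right]; split=> // u _ /size0nil ->; first exact: fnil.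
  by rewrite fnil.
have [m] := ubnP (n1 + n2); elim: m n1 n2 => // m IHm [|n1] n2 lt_m.
  by exists 0%N => T f s _; exists [::]; [exact: sub0seq | left; split=> // u /eqP->].
case: n2 lt_m => [|n2] lt_m.
  by exists 0%N => T f s _; exists [::]; [exact: sub0seq | right; split=> // u /eqP->].
have [N1 HN1] := IHm n1 n2.+1 ltac:(lia).
have [N2 HN2] := IHm n1.+1 n2 ltac:(lia).
have [N HN] := IHr N1 N2.
(* The tail is thinned to some [w] on which the colour of [x :: u] does not depend on [u]; [x] then
   extends what the recursion finds in [w], if the colours agree. *)
exists N.+1 => T f [//|x s] /= szs.
have [w ws [[szw fw]|[szw fw]]] := HN T (fun u => f (x :: u)) s szs.
- have [t tw [[szt ft]|[szt ft]]] := HN1 T f w szw; last first.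
    exists t; last by right.
    exact: subseq_trans tw (subseq_trans ws (subseq_cons s x)).
  exists (x :: t); first by rewrite /= eqxx (subseq_trans tw ws).
  left; split=> // -[//|y u] /= /[swap] -[szu]; case: eqP => [-> ut|_ ut].
    by apply: fw => //; apply: subseq_trans ut tw.
  by apply: ft => //=; rewrite szu.
- have [t tw [[szt ft]|[szt ft]]] := HN2 T f w szw.
    exists t; last by left.
    exact: subseq_trans tw (subseq_trans ws (subseq_cons s x)).
  exists (x :: t); first by rewrite /= eqxx (subseq_trans tw ws).
  right; split=> // -[//|y u] /= /[swap] -[szu]; case: eqP => [-> ut|_ ut].
    by apply: fw => //; apply: subseq_trans ut tw.
  by apply: ft => //=; rewrite szu.
Qed.

Lemma ramsey_family (r c n : nat) :
  exists N, forall (T : eqType) (f : nat -> pred (seq T)) (s : seq T),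
    (N <= size s)%N ->
  exists t, [/\ subseq t s, (n <= size t)%N &
    forall a, (a < c)%N ->
      (forall u, subseq u t -> size u = r -> f a u) \/
      (forall u, subseq u t -> size u = r -> ~~ f a u)].
Proof.
elim: c n => [|c IHc] n; first by exists n => T f s szs; exists s; split.
have [N1 HN1] := IHc n; have [N HN] := ramsey r N1 N1.
exists N => T f s /(HN T (f c))[w ws Hw].
have szw : (N1 <= size w)%N by case: Hw => -[].
have [t [tw szt Ht]] := HN1 T f w szw.
exists t; split=> [||a]; rewrite ?(subseq_trans tw ws) //.
rewrite ltnS leq_eqVlt => /predU1P[->|/Ht//].
by case: Hw => -[_ Hw]; [left | right] => u ut; apply: Hw; apply: subseq_trans ut tw.
Qed.

(** * Double counting and averaging *)

Lemma count_exchange (T1 T2 : Type) (s : seq T1) (W : seq T2) (g : T1 -> T2 -> bool) :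
  (\sum_(j <- s) count (g j) W = \sum_(x <- W) count (g^~ x) s)%N.
Proof.
under eq_bigr do rewrite -sum1_count big_mkcond.
by rewrite exchange_big; apply: eq_bigr => x _; rewrite -sum1_count [RHS]big_mkcond.
Qed.

Lemma popular_witness (T1 T2 : eqType) (s : seq T1) (W : seq T2) (g : T1 -> T2 -> bool) K :
  (0 < size W)%N -> {in s, forall j, size W <= K * count (g j) W}%N ->
  exists2 x, x \in W & (size s <= K * count (g^~ x) s)%N.
Proof.
move=> W0 sW; apply/hasP/negP => /negP/hasPn no.
have : (\sum_(j <- s) size W <= \sum_(j <- s) K * count (g j) W)%N.
  by rewrite big_seq [leqRHS]big_seq; apply: leq_sum.
rewrite -big_distrr /= count_exchange big_const_seq count_predT iter_addn_0.
have : (\sum_(x <- W) (K * count (g^~ x) s).+1 <= \sum_(x <- W) size s)%N.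
  rewrite big_seq [leqRHS]big_seq; apply: leq_sum => x /no.
  by rewrite -ltnNge.
rewrite [leqRHS]big_const_seq count_predT iter_addn_0.
under eq_bigr do rewrite -addn1.
rewrite big_split /= -big_distrr /= sum1_size; lia.
Qed.

Lemma unpopular_witness (T1 T2 : eqType) (s : seq T1) (W : seq T2) (g : T1 -> T2 -> bool) q :
  (0 < size s)%N -> {in W, forall x, count (g^~ x) s <= q}%N ->
  exists2 j, j \in s & (size s * count (g j) W <= q * size W)%N.
Proof.
move=> s0 sW; apply/hasP/negP => /negP/hasPn no.
have : (\sum_(x <- W) count (g^~ x) s <= \sum_(x <- W) q)%N.
  by rewrite big_seq [leqRHS]big_seq; apply: leq_sum.
rewrite -count_exchange big_const_seq count_predT iter_addn_0.
have : (\sum_(j <- s) (q * size W).+1 <= \sum_(j <- s) size s * count (g j) W)%N.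
  by rewrite big_seq [leqRHS]big_seq; apply: leq_sum => x /no; rewrite -ltnNge.
rewrite -big_distrr /= big_const_seq count_predT iter_addn_0.
set c := (\sum_(j <- s) _)%N; nia.
Qed.

(** * Sums over sequences and the second-moment bound *)

Section SeqCounting.
Context {R : realFieldType}.

Lemma sumr_nat_count (T : Type) (a : pred T) (s : seq T) :
  \sum_(x <- s) (a x)%:R = (count a s)%:R :> R.
Proof. by elim: s => [|x s IH]; rewrite ?big_nil // big_cons IH /= natrD. Qed.

Lemma sumr_seq_const (T : Type) (c : R) (s : seq T) :
  \sum_(x <- s) c = c * (size s)%:R.
Proof.
elim: s => [|x s IH]; first by rewrite big_nil mulr0.
by rewrite big_cons IH -natr1 mulrDr mulr1 addrC.
Qed.

Lemma ler_sum_in (T : eqType) (f g : T -> R) (s : seq T) :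
  {in s, forall x, f x <= g x} -> \sum_(x <- s) f x <= \sum_(x <- s) g x.
Proof.
by move=> fg; rewrite big_seq [leRHS]big_seq; apply: ler_sum.
Qed.

Lemma sum_sqr_bound (T : eqType) (W : seq T) (h : T -> R) (S : pred T) (s e : R) :
    0 <= s <= 1 -> 0 <= e <= 1 -> {in W, forall v, 0 <= h v <= 1} ->
    {in W, forall v, S v -> h v <= 1 - s} ->
    (s - e) * (size W)%:R <= (count S W)%:R ->
    (count (fun v => s + e <= h v) W)%:R <= e * (size W)%:R ->
  \sum_(v <- W) h v ^+ 2 <= (1 / 4 + 5 * e) * (size W)%:R.
Proof.
move=> /andP[s0 s1] /andP[e0 e1] h01 hS cS cB.
set n : R := (size W)%:R in cS cB *.
have n0 : 0 <= n by rewrite ler0n.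
set B := fun v => s + e <= h v in cB.
have B1 v : v \in W -> h v ^+ 2 <= (s + e) ^+ 2 + (B v)%:R.
  move=> /h01 /andP[h0 h1]; rewrite /B; case: (lerP (s + e)) => /= hB.
    by apply: (le_trans (exprn_ile1 2 h0 h1)); rewrite lerDr sqr_ge0.
  by rewrite addr0 ler_sqr ?nnegrE ?(ltW hB) // addr_ge0.
have se2 : (s + e) ^+ 2 <= s ^+ 2 + 3 * e by nra.
(* For s <= 1/2, the bound s + e outside [B] already suffices, since s^2 <= 1/4. *)
case: (lerP s (1 / 2)) => s2.
  apply: (le_trans (ler_sum_in B1)).
  rewrite big_split /= sumr_nat_count sumr_seq_const -/n.
  have le1 : (s + e) ^+ 2 + e <= 1 / 4 + 5 * e by nra.
  have := ler_wpM2r n0 le1; lra.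
(* [D] is the saving at each element of [S]; it is nonnegative as s > 1/2, so the lower bound on the
   size of [S] can be used. *)
set D := (s + e) ^+ 2 - (1 - s) ^+ 2.
have D0 : 0 <= D by rewrite /D; nra.
have B2 v : v \in W -> h v ^+ 2 <= (s + e) ^+ 2 - D * (S v)%:R + (B v)%:R.
  move=> vW; case Sv: (S v); last by rewrite mulr0 subr0 B1.
  have /andP[h0 _] := h01 v vW; rewrite mulr1 subKr.
  by rewrite -[leLHS]addr0 lerD // ler_sqr ?nnegrE ?subr_ge0 // hS.
apply: (le_trans (ler_sum_in B2)).
rewrite big_split /= sumrB sumr_seq_const -mulr_sumr !sumr_nat_count -/n.
(* This factor of [e] in the expansion accounts for the constant 5; what remains is s (1 - s) = 1/4
   - (s - 1/2)^2. *)
have le5 : 4 * s - 2 * s ^+ 2 + s * e + e + e ^+ 2 <= 5 by nra.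
have le1 : (s + e) ^+ 2 - D * (s - e) + e <= 1 / 4 + 5 * e.
  rewrite -subr_ge0.
  have -> : 1 / 4 + 5 * e - ((s + e) ^+ 2 - D * (s - e) + e) =
      (s - 1 / 2) ^+ 2 + e * (5 - (4 * s - 2 * s ^+ 2 + s * e + e + e ^+ 2)).
    by rewrite /D; field.
  by rewrite addr_ge0 ?sqr_ge0 // mulr_ge0 // subr_ge0.
have := ler_wpM2r n0 le1; have := ler_wpM2l D0 cS; move: cB.
move: (count S W)%:R (count B W)%:R; clearbody n D => c b; lra.
Qed.

End SeqCounting.

(** * Relative degrees and covered indices *)

Section Links.
Context {R : realFieldType} {I V : eqType} (P : I -> I -> seq V).
Context (T : I -> I -> I -> V -> V -> V -> bool) (eta : R).

(* The apex is i.  Asking for a proportion eta of P j k, instead of a single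
   vertex, is what makes few_misses possible. *)
Definition joined i j k x y :=
  eta * (size (P j k))%:R <= (count (T i j k x y) (P j k))%:R.

Definition nbs i j k y := count (fun x => joined i j k x y) (P i j).

Definition rdeg i j k y : R := (nbs i j k y)%:R / (size (P i j))%:R.

(* Non-isolated in the constituent with index set {l, k, t}. *)
Definition touched l k t z :=
  has (fun u => has (fun w => T l k t u w z) (P l t)) (P l k).

Definition uncovered i L k t z :=
  touched i k t z && ~~ has (fun l => touched l k t z) L.

Definition covered i L k t :=
  (count (uncovered i L k t) (P k t))%:R < eta * (size (P k t))%:R.

(** The threshold s is rounded to a multiple a/K, and a positive proportion means 1/K, so that
    finitely many colourings suffice for Ramsey. *)
Definition level K a i j k :=
  (size (P i k) <= K * count (fun y => (a%:R / K%:R <= rdeg i j k y)%R) (P i k))%N.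

(* The indices i, l, k, t are i1, i2, i3, i4 in the theorem. *)
Definition config i l k t := exists u v x z a b a' b',
  [/\ u \in P i l, v \in P i k, x \in P i t & z \in P k t] /\
  [/\ a \in P l k, b \in P l t, a' \in P l k & b' \in P l t] /\
  [/\ T i l k u v a, T i l t u x b, T i k t v x z & T l k t a' b' z].

Lemma rdeg_itv i j k y : 0 <= rdeg i j k y <= 1.
Proof.
rewrite /rdeg divr_ge0 ?ler0n //=.
(* Division by zero makes the degree 0 for an empty class. *)
have [->|s0] := posnP (size (P i j)); first by rewrite invr0 mulr0.
by rewrite ler_pdivrMr ?ltr0n // mul1r ler_nat count_size.
Qed.

(** For fixed [y], the edges whose pairs xy and zy are both joined lie in the product of the two
    neighbourhoods of [y]. Each pair that is not joined has a small codegree, so either kind of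
    remaining edge costs at most a proportion [eta]. *)
Lemma edges_le_rdeg i j k :
    (forall x y z, T k j i z y x = T i j k x y z) ->
    P j i = P i j -> P k j = P j k -> P k i = P i k ->
    0 <= eta -> (0 < size (P i j))%N -> (0 < size (P j k))%N ->
  \sum_(y <- P i k) \sum_(x <- P i j) (count (T i j k x y) (P j k))%:R <=
  (size (P i j))%:R * (size (P j k))%:R *
    (\sum_(y <- P i k) rdeg i j k y * rdeg k j i y + 2 * eta * (size (P i k))%:R).
Proof.
move=> Tsym Pji Pkj Pki eta0 ij0 jk0.
set m : R := (size (P i j))%:R; set n : R := (size (P j k))%:R.
have m0 : 0 < m by rewrite ltr0n.
have n0 : 0 < n by rewrite ltr0n.
rewrite -sumr_seq_const -big_split /= mulr_sumr; apply: ler_sum => y _.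
have -> : m * n * (rdeg i j k y * rdeg k j i y + 2 * eta) =
    (nbs i j k y)%:R * (nbs k j i y)%:R + eta * n * m + eta * m * n.
  rewrite /rdeg Pkj -/m -/n; field; by rewrite !gt_eqF.
set G1 := joined i j k ^~ y; set G2 := joined k j i ^~ y.
apply: (@le_trans _ _ (\sum_(x <- P i j) (\sum_(z <- P j k) ((G1 x)%:R * (G2 z)%:R +
   (~~ G1 x)%:R * (T i j k x y z)%:R + (~~ G2 z)%:R * (T i j k x y z)%:R)))).
  apply: ler_sum => x _; rewrite -sumr_nat_count; apply: ler_sum => z _.
  case: (G1 x); case: (G2 z); case: (T _ _ _ _ _ _) => /=;
    by rewrite ?(mul0r, mulr0, mulr1, addr0, add0r) // ?lerDl ?ler01 // ?ler0n.
under eq_bigr do rewrite 2!big_split /= -!mulr_sumr.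
rewrite 2!big_split /=; apply: lerD; first apply: lerD.
- rewrite -mulr_suml !sumr_nat_count.
  by rewrite /nbs Pkj.
- rewrite -sumr_seq_const; apply: ler_sum => x _.
  rewrite sumr_nat_count /G1 /joined -ltNge; case: ltP => [/ltW|_]; rewrite ?mul1r //.
  by rewrite mul0r mulr_ge0 ?ler0n.
- rewrite exchange_big /= -sumr_seq_const; apply: ler_sum => z _.
  rewrite -mulr_sumr.
  under eq_bigr do rewrite -Tsym.
  rewrite sumr_nat_count /G2 /joined Pji -ltNge.
  case: ltP => [/ltW|_]; rewrite ?mul1r //.
  by rewrite mul0r mulr_ge0 ?ler0n.
Qed.

Definition heavy c i j k :=
  c * (size (P i k))%:R <= \sum_(y <- P i k) rdeg i j k y ^+ 2.

(** The margin [2 * eta] in the density pays for the edges at pairs that are not joined; AM-GM does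
    the rest. *)
Lemma heavy_or c i j k :
    (forall x y z, T k j i z y x = T i j k x y z) ->
    P j i = P i j -> P k j = P j k -> P k i = P i k ->
    0 <= eta -> (0 < size (P i j))%N -> (0 < size (P j k))%N ->
    (c + 2 * eta) * (size (P i j))%:R * (size (P i k))%:R * (size (P j k))%:R <=
      \sum_(y <- P i k) \sum_(x <- P i j) (count (T i j k x y) (P j k))%:R ->
  heavy c i j k || heavy c k j i.
Proof.
move=> Tsym Pji Pkj Pki eta0 ij0 jk0 dens.
have := le_trans dens (edges_le_rdeg Tsym Pji Pkj Pki eta0 ij0 jk0).
rewrite /heavy Pki.
set m : R := (size (P i j))%:R; set n : R := (size (P j k))%:R.
set w : R := (size (P i k))%:R.
have m0 : 0 < m by rewrite ltr0n.
have n0 : 0 < n by rewrite ltr0n.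
have -> : (c + 2 * eta) * m * w * n = m * n * ((c + 2 * eta) * w) by ring.
rewrite ler_pM2l ?mulr_gt0 // => le1; apply/orP.
case: lerP => [|lt1]; [by left | right].
apply/contraT; rewrite -ltNge => lt2.
have : 2 * \sum_(y <- P i k) rdeg i j k y * rdeg k j i y <=
  \sum_(y <- P i k) rdeg i j k y ^+ 2 +
  \sum_(y <- P i k) rdeg k j i y ^+ 2.
  rewrite mulr_sumr -big_split /=; apply: ler_sum => y _.
  rewrite -subr_ge0.
  have -> : forall a b : R, a ^+ 2 + b ^+ 2 - 2 * (a * b) = (a - b) ^+ 2.
    by move=> a b; ring.
  exact: sqr_ge0.
lra.
Qed.

(* Among 2q + 1 consecutive indices, the sets left uncovered by the next q indices
   are disjoint for the first q + 1, so they cannot all have proportion eta. *)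
Lemma covered_exists (e : seq I) k t q :
    (2 * q < size e)%N -> (0 < size (P k t))%N -> 1 < q.+1%:R * eta ->
  exists i L, [/\ subseq (i :: L) e, size L = q & covered i L k t].
Proof.
move=> sze kt0 qeta; have i0 : I by case: e sze.
pose L (j : nat) := take q (drop j.+1 e).
pose b (j : nat) := uncovered (nth i0 e j) (L j) k t.
have szL j : (j <= q)%N -> size (L j) = q.
  by move=> jq; rewrite size_take size_drop; case: ltnP => //; lia.
case: (altP (@forallP 'I_q.+1 (fun j => ~~ covered (nth i0 e j) (L j) k t))); last first.
  rewrite negb_forall => /existsP[j]; rewrite negbK => cov.
  exists (nth i0 e j), (L j); split=> //; last by rewrite szL // -ltnS.
  have je : (j < size e)%N by have := ltn_ord j; lia.
  rewrite -[X in subseq _ X](cat_take_drop j) (drop_nth i0 je).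
  apply: subseq_trans (suffix_subseq _ _).
  by rewrite /= eqxx take_subseq.
move=> unc; exfalso.
have once z : (\sum_(j < q.+1) b j z <= 1)%N.
  case: (altP (@existsP 'I_q.+1 (fun j => b j z))) => [[j0]|]; last first.
    rewrite negb_exists => /forallP nb; rewrite big1 // => j _.
    by rewrite (negbTE (nb j)).
  move=> bj0.
  have uniq_b (j1 j2 : 'I_q.+1) : (j1 < j2)%N -> b j1 z -> b j2 z -> False.
    move=> lt12 /andP[_ /hasP no] /andP[t2 _]; apply: no.
    exists (nth i0 e j2) => //; have := ltn_ord j2 => j2q.
    have -> : nth i0 e j2 = nth i0 (L j1) (j2 - j1.+1).
      by rewrite nth_take ?nth_drop; [congr nth; lia | lia].
    by rewrite mem_nth // szL; lia.
  rewrite (bigD1 j0) //= big1 ?addn0 ?leq_b1 // => j jj0.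
  case bj: (b j z) => //; exfalso.
  have [jj|jj|/val_inj/eqP] := ltngtP j j0; last by rewrite (negbTE jj0).
    exact: uniq_b jj bj bj0.
  exact: uniq_b jj bj0 bj.
have : (\sum_(z <- P k t) \sum_(j < q.+1) b j z)%N%:R <= (size (P k t))%:R :> R.
  by rewrite ler_nat -sum1_size leq_sum.
rewrite exchange_big /= natr_sum.
apply/negP; rewrite -ltNge.
have : \sum_(j < q.+1) eta * (size (P k t))%:R <=
   \sum_(j < q.+1) (\sum_(z <- P k t) b j z)%N%:R :> R.
  apply: ler_sum => j _; have := unc j; rewrite /covered -leNgt => /le_trans; apply.
  by rewrite ler_nat -sum1_count big_mkcond leq_sum // => z _; rewrite /b; case: uncovered.
apply: lt_le_trans; rewrite sumr_const card_ord -[ltRHS]mulr_natl mulrA.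
by rewrite ltr_pMl // ltr0n.
Qed.

(** A common neighbour u of [v] and [x] in [P i l] would complete a configuration, the primed
    vertices coming from [touched]. Hence the two neighbourhoods are disjoint and their proportions
    add up to at most 1. *)
Lemma rdeg_disjoint i l k t v x z :
    ~ config i l k t -> 0 < eta ->
    (0 < size (P i l))%N -> (0 < size (P l k))%N -> (0 < size (P l t))%N ->
    v \in P i k -> x \in P i t -> z \in P k t ->
    T i k t v x z -> touched l k t z ->
  rdeg i l k v <= 1 - rdeg i l t x.
Proof.
move=> noconf eta0 il0 lk0 lt0 vP xP zP Tz /hasP[a' a'P /hasP[b' b'P Tab]].
rewrite lerBrDr /rdeg -mulrDl ler_pdivrMr ?ltr0n // mul1r -natrD ler_nat.
have joinedP j (u w : V) : (0 < size (P l j))%N -> joined i l j u w ->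
    exists2 a, a \in P l j & T i l j u w a.
  move=> lj0 J; apply/hasP; rewrite has_count -(ltr0n R).
  by apply: lt_le_trans J; rewrite mulr_gt0 ?ltr0n.
rewrite /nbs -count_predUI [X in (_ + X)%N](_ : _ = 0%N) ?addn0 ?count_size //.
apply/eqP; rewrite -leqn0 leqNgt -has_count; apply/hasPn => u uP /=.
apply/negP => /andP[/(joinedP _ _ _ lk0)[a aP Ta] /(joinedP _ _ _ lt0)[b bP Tb]].
apply: noconf; exists u, v, x, z, a, b, a', b'.
by split; split.
Qed.

(* The z that complete v and x to an edge are touched by i; if q of the l did not
   touch any of them, these z would be too numerous to be uncovered. *)
Lemma few_misses i L k t x v q :
    x \in P i t -> v \in P i k ->
    (forall L', subseq L' L -> size L' = q -> covered i L' k t) ->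
    joined i k t v x ->
  (count (fun l => ~~ has (fun z => T i k t v x z && touched l k t z) (P k t)) L
    <= q)%N.
Proof.
move=> xP vP cov J; rewrite leqNgt; apply/negP => gtq.
set m := fun l => _ in gtq.
have sL' : subseq (take q [seq l <- L | m l]) L.
  exact: subseq_trans (take_subseq _ _) (filter_subseq _ _).
have szL' : size (take q [seq l <- L | m l]) = q.
  by rewrite size_take size_filter gtq.
have := cov _ sL' szL'; apply/negP; rewrite /covered -leNgt.
apply: le_trans J _; rewrite ler_nat -!size_filter -!sum1_size !big_filter.
rewrite big_seq_cond [leqRHS]big_seq_cond !(big_mkcond (fun _ => _ && _)) /=.
apply: leq_sum => z _; case: (boolP (z \in P k t)) => //= zP.
case Tz: (T i k t v x z) => //; rewrite /uncovered.
have -> /= : touched i k t z.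
  by apply/hasP; exists v => //; apply/hasP; exists x.
case: ifPn => //; rewrite negbK => /hasP[l /mem_take].
rewrite mem_filter => /andP[/hasPn /(_ z zP)]; rewrite Tz /= => /negP nt _ t0.
by case: nt.
Qed.

(** * The configuration in a homogeneous sequence of indices *)

Lemma config_of_homogeneous c K q a i w t :
    (0 < K)%N -> (0 < q)%N -> (a <= K)%N -> 0 < eta -> 1 / 4 + 5 / K%:R < c ->
    uniq (i :: rcons w t) -> (K * (q * K).+1 <= size w)%N ->
    (forall j k, j != k -> (0 < size (P j k))%N) ->
    (forall j k, subseq [:: i; j; k] (i :: rcons w t) ->
      [/\ heavy c i j k, level K a i j k &
          ~~ level K a.+1 i j k]) ->
    (forall L k, subseq (i :: rcons (rcons L k) t) (i :: rcons w t) ->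
      size L = q -> covered i L k t) ->
  exists l k, uniq [:: i; l; k; t] /\ config i l k t.
Proof.
move=> K0 q0 aK eta0 cK us szw Pn0 Htri Hcov.
have sub1 L : subseq L w -> subseq (i :: rcons L t) (i :: rcons w t).
  by move=> Lw; rewrite /= eqxx -!cats1 cat_subseq.
have sub2 L : subseq L w -> subseq (i :: L) (i :: rcons w t).
  by move=> Lw; rewrite /= eqxx (subseq_trans Lw) ?subseq_rcons.
have KR0 : 0 < K%:R :> R by rewrite ltr0n.
have it : i != t.
  by move: us; rewrite /= mem_rcons inE negb_or => /andP[/andP[]].
(* By [level], each j in [w] accepts a proportion 1/K of the x, so some x is accepted by at least a
   proportion 1/K of the j. *)
have [x xP] := popular_witness (W := P i t)
  (g := fun j x => a%:R / K%:R <= rdeg i j t x) (K := K) (s := w)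
  (Pn0 _ _ it) ltac:(by move=> j jw; case: (Htri j t (sub1 [:: j] _));
    rewrite ?sub1seq).
set g := fun j => a%:R / K%:R <= rdeg i j t x.
move=> /(leq_trans szw); rewrite leq_pmul2l // -size_filter.
have := filter_subseq g w; have : all g (filter g w) by apply: filter_all.
(* The last accepted index serves as [k], so that all candidates for [l] precede it; at least
   [q * K] of them remain. *)
case/lastP: (filter g w) => [//|L k]; rewrite all_rcons size_rcons ltnS.
move=> /andP[gk /allP gL] Lkw szL.
have Lw : subseq L w by apply: subseq_trans Lkw; apply: subseq_rcons.
have kw : k \in w by rewrite (mem_subseq Lkw) // mem_rcons mem_head.
have ik : i != k.
  move: us; rewrite /= mem_rcons inE negb_or => /andP[/andP[_ iw] _].
  by apply: contraNneq iw => ->.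
pose hit l v := has (fun z => T i k t v x z && touched l k t z) (P k t).
pose miss l v := joined i k t v x && ~~ hit l v.
have missq : {in P i k, forall v, count (miss^~ v) L <= q}%N.
  move=> v vP; rewrite /miss; case J: (joined _ _ _ _ _); last first.
    by rewrite count_pred0.
  apply: few_misses => // L' sL' szL'.
  apply: Hcov => //; apply: sub1; apply: subseq_trans Lkw.
  by rewrite -!cats1 cat_subseq.
have szL0 : (0 < size L)%N by apply: leq_trans szL; rewrite muln_gt0 q0.
(* Each [v] is missed by at most [q] of the at least [q * K] candidates, so some [l] misses at most
   a proportion 1/K of the [v]. *)
have [l lL lmiss] := unpopular_witness szL0 missq.
have lmissK : (K * count (miss l) (P i k) <= size (P i k))%N.
  rewrite -(leq_pmul2l q0) mulnA; apply: leq_trans lmiss.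
  by rewrite leq_mul2r szL orbT.
have lkw : subseq [:: l; k] w.
  by apply: subseq_trans Lkw; rewrite -cats1 -[[:: l; k]]/([:: l] ++ [:: k]) cat_subseq // sub1seq.
exists l, k; have ulkt : uniq [:: i; l; k; t].
  exact: subseq_uniq (sub1 _ lkw) us.
split=> //.
have [//|noconf] := classic (config i l k t).
have [il lk lt] : [/\ i != l, l != k & l != t].
  move: ulkt; rewrite /= !inE !negb_or.
  by move=> /and4P[/and3P[-> _ _] /andP[-> ->]].
have [hlk _ lev] := Htri l k (sub2 _ lkw).
have gl := gL l lL.
pose S v := joined i k t v x && hit l v.
have bound : \sum_(v <- P i k) rdeg i l k v ^+ 2 <=
    (1 / 4 + 5 * K%:R^-1) * (size (P i k))%:R.
  (* Here e = 1/K bounds the missed [v], the rounding of s and the exceptional [v] alike. *)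
  apply: (sum_sqr_bound (S := S) (s := a%:R / K%:R)).
  - by rewrite divr_ge0 ?ler0n //= ler_pdivrMr // mul1r ler_nat.
  - by rewrite invr_ge0 ler0n invf_le1 // ler1n.
  - by move=> v _; apply: rdeg_itv.
  - move=> v vP /andP[_ /hasP[z zP /andP[Tz tz]]].
    apply: le_trans (rdeg_disjoint noconf eta0 _ _ _ vP xP zP Tz tz) _; try exact: Pn0.
    by rewrite lerB.
  - have : (nbs i k t x <= count S (P i k) + count (miss l) (P i k))%N.
      rewrite -count_predUI; apply: leq_trans (leq_addr _ _).
      apply: sub_count => v /= J; rewrite /S /miss J /=.
      by rewrite orbN.
    move: gk; rewrite /g /rdeg ler_pdivlMr ?ltr0n ?Pn0 // => gk.
    rewrite -(ler_nat R) natrD => le1.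
    rewrite mulrBl lerBlDr; apply: le_trans (le_trans gk le1) _.
    by rewrite lerD2l -ler_pdivrMl ?invr_gt0 // invrK -natrM ler_nat.
  - move: lev; rewrite /level -ltnNge => /ltnW.
    rewrite -(ler_nat R) natrM -ler_pdivlMl //; apply: le_trans.
    rewrite ler_nat; apply: sub_count => v /=.
    by rewrite -natr1 mulrDl mul1r.
have := le_trans hlk bound; rewrite leNgt ltr_pM2r ?cK // ltr0n.
exact: Pn0.
Qed.

End Links.

(** * Passing to homogeneous indices *)

Lemma exists_last_true (f : nat -> bool) n :
  f 0%N -> ~~ f n -> exists2 a, (a < n)%N & f a && ~~ f a.+1.
Proof.
move=> f0; elim: n => [|n IHn]; first by rewrite f0.
case fn: (f n) => nfn; first by exists n => //; rewrite fn.
have [|a an fa] := IHn; first by rewrite fn.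
by exists a => //; apply: ltnW.
Qed.

Lemma config_of_heavy (R : realFieldType) (c eta : R) K q :
    (0 < K)%N -> (0 < q)%N -> 0 < eta -> 1 / 4 + 5 / K%:R < c ->
    1 < q.+1%:R * eta ->
  exists N, forall (I V : eqType) (P : I -> I -> seq V)
      (T : I -> I -> I -> V -> V -> V -> bool) (s : seq I),
    uniq s -> (N <= size s)%N ->
    (forall i j, i != j -> (0 < size (P i j))%N) ->
    (forall i j k, subseq [:: i; j; k] s -> heavy P T eta c i j k) ->
  exists i l k t, uniq [:: i; l; k; t] /\ config P T i l k t.
Proof.
move=> K0 q0 eta0 cK qeta.
(* The first bound leaves room for i and t around [w]; the second leaves more than [2 * q] indices
   before the last two, as [covered_exists] requires. *)
have [n [nK n5]] : exists n, (K * (q * K).+1 + 2 <= n)%N /\ (2 * q + 5 <= n)%N.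
  exists (K * (q * K).+1 + 2 * q + 5)%N; rewrite -addnA leq_addl; split=> //.
  by rewrite leq_add2l; lia.
(* The coloured sequences consist of i, the [q] indices of L, k and t. *)
have [N2 HN2] := ramsey q.+3 n n.
have [N1 HN1] := ramsey_family 3 K.+2 N2.
exists N1 => I V P T s us szs Pn0 hs.
pose flev a (u : seq I) :=
  if u is [:: i; j; k] then level P T eta K a i j k else true.
pose fcov u := if u is i :: v then
  (if rev v is t :: k :: L then covered P T eta i (rev L) k t else true) else true.
have fcovE i L k t : fcov (i :: rcons (rcons L k) t) = covered P T eta i L k t.
  by rewrite /fcov !rev_rcons revK.
have [s1 [s1s szs1 hom1]] := HN1 I flev s szs.
have [s2 s2s1 hom2] := HN2 I fcov s1 szs1.
have s2s := subseq_trans s2s1 s1s; have us2 := subseq_uniq s2s us.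
(* The uncovered colour cannot prevail, by [covered_exists] applied before the last two indices. *)
have {hom2 szs1} [szs2 hom2] : (n <= size s2)%N /\
    forall u, subseq u s2 -> size u = q.+3 -> fcov u.
  case: hom2 => // -[szs2 hom2]; exfalso.
  case/lastP: s2 s2s1 s2s us2 szs2 hom2 => [|s2 t]; first by move=> _ _ _ /=; lia.
  case/lastP: s2 => [|e k] _ _ us2; rewrite !size_rcons => szs2 hom2.
    by move: szs2 => /=; lia.
  have kt : k != t.
    by move: us2; rewrite rcons_uniq mem_rcons inE negb_or eq_sym => /andP[/andP[]].
  have [|i [L [iLe szL cov]]] := covered_exists T _ (Pn0 _ _ kt) qeta (e := e).
    by lia.
  have : ~~ fcov (i :: rcons (rcons L k) t).
    apply: hom2; last by rewrite /= !size_rcons szL.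
    by rewrite -!rcons_cons -!cats1 !cat_subseq.
  by rewrite fcovE cov.
case: s2 s2s1 s2s us2 szs2 hom2 => [|i s2]; first by move=> _ _ _ /=; lia.
case/lastP: s2 => [|w t] s2s1 s2s us2; first by move=> /=; lia.
rewrite /= size_rcons => szw hom2.
(* Level 0 always holds and level K + 1 never does, as degrees are at most 1. The last level that
   holds at one triple is by homogeneity the last at all of them. *)
have [a aK flevP] : exists2 a, (a <= K)%N & forall j k,
    subseq [:: i; j; k] (i :: rcons w t) ->
    level P T eta K a i j k && ~~ level P T eta K a.+1 i j k.
  have [j0 jw] : exists j0, j0 \in w.
    case: (w) szw => [|j0 w'] /= szw'; first by lia.
    by exists j0; rewrite mem_head.
  have sub0 : subseq [:: i; j0; t] (i :: rcons w t).
    by rewrite /= eqxx -[_ :: _]/(rcons [:: j0] t) -!cats1 cat_subseq // sub1seq.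
  have it : i != t.
    by move: us2; rewrite /= mem_rcons inE negb_or => /andP[/andP[]].
  have KR0 : 0 < K%:R :> R by rewrite ltr0n.
  have lev0 : level P T eta K 0 i j0 t.
    rewrite /level (eq_count (a2 := predT)) ?count_predT ?leq_pmull // => y /=.
    by rewrite mul0r; case/andP: (rdeg_itv P T eta i j0 t y).
  have levK : ~~ level P T eta K K.+1 i j0 t.
    rewrite /level (eq_count (a2 := pred0)) ?count_pred0 ?muln0 -?ltnNge ?Pn0 //.
    move=> y /=; apply/negP => le1; have := rdeg_itv P T eta i j0 t y.
    case/andP=> _; apply/negP; rewrite -ltNge; apply: lt_le_trans le1.
    by rewrite ltr_pdivlMr // mul1r ltr_nat.
  have [a aK /andP[la lSa]] := exists_last_true (f := fun a => level P T eta K a i j0 t) lev0 levK.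
  have homE b : (b < K.+2)%N -> forall j k, subseq [:: i; j; k] (i :: rcons w t) ->
      level P T eta K b i j k = level P T eta K b i j0 t.
    move=> bK j k sjk; have sub1 u : subseq u (i :: rcons w t) -> subseq u s1.
      by move/subseq_trans; apply.
    case: (hom1 b bK) => hom; have := hom _ (sub1 _ sjk) erefl;
      have := hom _ (sub1 _ sub0) erefl; rewrite /flev; first by move=> -> ->.
    by move=> /negbTE -> /negbTE ->.
  have aK2 : (a < K.+2)%N by apply: leq_trans aK _.
  exists a => [|j k sjk]; first by rewrite -ltnS.
  by apply/andP; split; [rewrite (homE a aK2 j k sjk) | rewrite (homE a.+1 _ j k sjk)].
have [| | |l [k [ulk conf]]] := config_of_homogeneous (P := P) (T := T) K0 q0 aK eta0 cK us2 _ Pn0.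
- by move: (leq_trans nK szw); rewrite addn2.
- move=> j k sjk; have /andP[? ?] := flevP j k sjk; split=> //.
  by apply: hs; apply: subseq_trans sjk s2s.
- move=> L k sLk szL; rewrite -fcovE; apply: hom2 => //.
  by rewrite /= !size_rcons szL.
by exists i, l, k, t.
Qed.

(** * Application to reduced hypergraphs *)

Lemma card_edges_le (I V : choiceType) (A : reduced_hypergraph I V) (i j k : I) :
    uniq [:: i; j; k] ->
  (#|` rh_edges A [fset i; j; k]| <=
   \sum_(y <- rh_class A [fset i; k]) \sum_(x <- rh_class A [fset i; j])
     count (fun z => [fset x; y; z] \in rh_edges A [fset i; j; k])
       (rh_class A [fset j; k]))%N.
Proof.
move=> uijk; set E := rh_edges A _.
pose s := flatten [seq flatten [seq [seq [fset x; y; z] |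
    z <- rh_class A [fset j; k] & [fset x; y; z] \in E]
  | x <- rh_class A [fset i; j]] | y <- rh_class A [fset i; k]].
have sub : {subset E <= s}.
  move=> e eE; have [x [y [z [xP yP zP ee]]]] := rh_edges_tripartite uijk eE.
  apply/flatten_mapP; exists y => //; apply/flatten_mapP; exists x => //.
  by apply/mapP; exists z; rewrite // mem_filter -ee eE.
apply: leq_trans (uniq_leq_size (fset_uniq E) sub) _.
rewrite /s size_flatten /shape -map_comp sumnE big_map; apply: leq_sum => y _ /=.
rewrite size_flatten /shape -map_comp sumnE big_map; apply: leq_sum => x _ /=.
by rewrite size_map size_filter.
Qed.

Theorem theorem1p2 (R : realType) (eps : R) (eps_gt0 : 0 < eps) :
  exists M : nat,
  forall (I V : choiceType) (A : reduced_hypergraph I V),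
    card_at_least I M ->
    dense (1 / 4 + eps) A ->
  exists i1 i2 i3 i4 : I,
    uniq [:: i1; i2; i3; i4] /\
  exists a12 a13 a14 a23 a24 a34 a'23 a'24 : V,
    [/\ a12 \in rh_class A [fset i1; i2],
        a13 \in rh_class A [fset i1; i3],
        a14 \in rh_class A [fset i1; i4],
        a23 \in rh_class A [fset i2; i3] &
        a24 \in rh_class A [fset i2; i4]] /\
    [/\ a34 \in rh_class A [fset i3; i4],
        a'23 \in rh_class A [fset i2; i3] &
        a'24 \in rh_class A [fset i2; i4]] /\
    [/\ [fset a13; a14; a34] \in rh_edges A [fset i1; i3; i4],
        [fset a12; a13; a23] \in rh_edges A [fset i1; i2; i3],
        [fset a12; a14; a24] \in rh_edges A [fset i1; i2; i4] &
        [fset a'23; a'24; a34] \in rh_edges A [fset i2; i3; i4]].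
Proof.
(* Chosen so that c + 2 eta = 1/4 + eps, while c stays above 1/4 by a margin that 5/K can
   undercut. *)
pose eta := eps / 4; pose c := 1 / 4 + eps / 2.
have eta0 : 0 < eta by rewrite divr_gt0.
have [K [K0 cK]] : exists K, (0 < K)%N /\ 1 / 4 + 5 / K%:R < c.
  have := archi_boundP (ltW (divr_gt0 (ltr0n R 10) eps_gt0)).
  set K := Num.bound _ => ltK; exists K.+1; split=> //.
  rewrite /c ltrD2l ltr_pdivrMr ?ltr0n //.
  move: ltK; rewrite ltr_pdivrMr // -natr1; nra.
have [q [q0 qeta]] : exists q, (0 < q)%N /\ 1 < q.+1%:R * eta.
  have := archi_boundP (ltW (divr_gt0 ltr01 eta0)).
  set q := Num.bound _ => ltq; exists q.+1; split=> //.
  by move: ltq; rewrite ltr_pdivrMr // -!natr1; nra.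
have [N HN] := config_of_heavy K0 q0 eta0 cK qeta.
have [M HM] := ramsey 3 N N.
exists M => I V A [J szJ] dA.
pose P (i j : I) : seq V := rh_class A [fset i; j].
pose T (i j k : I) x y z := [fset x; y; z] \in rh_edges A [fset i; j; k].
have Psym i j : P j i = P i j by rewrite /P fsetUC.
have rev3 (X : choiceType) (a b d : X) : [fset d; b; a] = [fset a; b; d].
  by rewrite fsetUC fsetUA fsetUAC [[fset a] `|` _ `|` _]fsetUAC fsetUAC.
have Tsym i j k x y z : T k j i z y x = T i j k x y z.
  by rewrite /T rev3 [[fset k; j; i]]rev3.
have Pn0 i j : i != j -> (0 < size (P i j))%N.
  by move=> ij; rewrite lt0n cardfs_eq0; apply: rh_class_neq0.
have heavyP i j k : uniq [:: i; j; k] ->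
    heavy P T eta c i j k || heavy P T eta c k j i.
  move=> uijk; have [ij jk] : i != j /\ j != k.
    by move: uijk; rewrite /= !inE negb_or => /andP[/andP[-> _] /andP[-> _]].
  apply: heavy_or => //; try exact: Pn0; first exact: ltW.
  have -> : c + 2 * eta = 1 / 4 + eps by rewrite /c /eta; field.
  apply: le_trans (dA i j k uijk) _.
  have := card_edges_le A uijk; rewrite -(ler_nat R) => /le_trans; apply.
  by rewrite natr_sum; apply: ler_sum => y _; rewrite natr_sum.
suff [i [l [k [t [u [a12 [a13 [a14 [a34 [a23 [a24 [b23 [b24]]]]]]]]]]]]] :
    exists i l k t, uniq [:: i; l; k; t] /\ config P T i l k t.
  move=> [[? ? ? ?] [[? ? ? ?] [? ? ? ?]]].
  exists i, l, k, t; split=> //.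
  by exists a12, a13, a14, a23, a24, a34, b23, b24; split; [|split].
pose f u := if u is [:: i; j; k] then heavy P T eta c i j k else true.
have [s sJ [[szs fs]|[szs fs]]] := HM I f J szJ.
  have us := subseq_uniq sJ (fset_uniq J).
  apply: (HN I V P T s) => // i j k sijk.
  exact: fs [:: i; j; k] sijk erefl.
have us := subseq_uniq sJ (fset_uniq J).
(* No triple of [s] is heavy at its lowest apex, so all are heavy at the highest, which is the
   lowest in the reversed order. *)
apply: (HN I V P T (rev s)); rewrite ?rev_uniq ?size_rev // => i j k.
rewrite -[X in subseq X]revK subseq_rev => skji.
have /orP[|//] := heavyP _ _ _ (subseq_uniq skji us).
by move/negP: (fs [:: k; j; i] skji erefl).
Qed.
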